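(* Consider an asynchronous message-passing system of $n$ processes with unique identifiers, at most $f$ of which may crash, augmented with the failure detector $\diamond\mathcal{N}$. The implementation $\diamond\mathcal{N}\diamond\mathcal{P}$ (Algorithm 4, given in the context), with the variable $suspect$ at each process taken as the emulated failure detector output, guarantees Strong Completeness and Eventual Strong Accuracy.
   Context: Model. $P=\{p_1,\dots,p_n\}$ is a set of $n$ processes; time ranges over $\mathbb{N}$. A failure pattern is a function $F:\mathbb{N}\to 2^P$, where $F(t)$ is the set of processes that have crashed by time $t$; processes fail only by crashing (halting permanently), so $F(t)\subseteq F(t+1)$. Put $crashed(F)=\bigcup_{t}F(t)$ and $correct(F)=P\setminus crashed(F)$; at least one process is correct, and $|crashed(F)|\le f$. The system is asynchronous: every pair of processes is connected by a reliable channel, with unbounded but finite message delays. The primitive broadcast$(m)$ sends $m$ to every process, including the sender. Processes have unique identifiers and every received message can be attributed to its sender. Failure detector $\diamond\mathcal{N}$. A history is a function $H:P\times\mathbb{N}\to\{0,\dots,n\}$, where $H(q,t)$ is the number of processes that $q$'s module suspects to have crashed at time $t$. It is admissible for $F$ iff: (Completeness) there is $t$ such that $H(q,t')\ge |crashed(F)|$ for all $t'\ge t$ and $q\in P$; (Eventual Accuracy) there is $t$ such that $H(q,t')\le |crashed(F)|$ for all $t'>t$ and $q\in correct(F)$. In the algorithm, $\diamond\mathcal{N}$ denotes the number of processes currently believed to be alive; this value is always at least $n-f$, i.e. it is $\max\{n-H(q,t),\,n-f\}$ at process $q$ at time $t$. Algorithm 4 (code for each process). Initially $r\leftarrow 0$,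 $suspect\leftarrow\emptyset$. Loop forever: (1) $r\leftarrow r+1$; (2) broadcast $(ALIVE,r)$; (3) wait until $\diamond\mathcal{N}$ messages $(ALIVE,r)$ have been received, $AL$ being the set of their senders; (4) $suspect\leftarrow P\setminus AL$. Properties. A process $p$ suspects $q$ at a given time if $q$ belongs to the variable $suspect$ of $p$ at that time. Strong Completeness: eventually every process that crashes is permanently suspected by every correct process. Eventual Strong Accuracy: there is a time after which correct processes are not suspected by any correct process. *)

(* Defs.v *)
From HB Require Import structures.
From mathcomp Require Import all_boot.
From mathcomp Require Import boolp.

Set Implicit Arguments.
Unset Strict Implicit.
Unset Printing Implicit Defensive.

(* Processes are the elements of 'I_n; the ordinal itself is the identifier. *)

Definition crashed n (F : nat -> {set 'I_n}) : {set 'I_n} :=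
  [set p | `[< exists t, p \in F t >]].

Definition correct n (F : nat -> {set 'I_n}) : {set 'I_n} := ~: crashed F.

Record failure_pattern n (f : nat) (F : nat -> {set 'I_n}) : Prop := {
  fp_crash_stop : forall t, F t \subset F t.+1;
  fp_some_correct : exists p, p \in correct F;
  fp_at_most_f : #|crashed F| <= f
}.

(* Histories H q t range over {0, ..., n}, that is 'I_n.+1. *)

Definition dN_completeness n (F : nat -> {set 'I_n})
    (H : 'I_n -> nat -> 'I_n.+1) : Prop :=
  exists t, forall t' q, t <= t' -> #|crashed F| <= H q t'.

Definition dN_eventual_accuracy n (F : nat -> {set 'I_n})
    (H : 'I_n -> nat -> 'I_n.+1) : Prop :=
  exists t, forall t' q, t < t' -> q \in correct F -> H q t' <= #|crashed F|.

Definition dN_admissible n (F : nat -> {set 'I_n})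
    (H : 'I_n -> nat -> 'I_n.+1) : Prop :=
  dN_completeness F H /\ dN_eventual_accuracy F H.

(* The number of processes currently believed to be alive.  If n < f, the
   truncated n - f is 0 and the maximum is that of the integers, as H q t <= n. *)
Definition dN_alive n f (H : 'I_n -> nat -> 'I_n.+1) (q : 'I_n) (t : nat) :=
  maxn (n - H q t) (n - f).

Record message := ALIVE { message_round : nat }.
HB.instance Definition _ := [isNew for message_round].
HB.instance Definition _ := [Equality of message by <:].

(* Control point of a process.  A broadcast is not atomic: [Broadcast D] means
   that the message has still to be sent to the processes of D, so a process
   may crash having sent its message to only some processes.  [Update AL] is
   the point after the wait, with AL the set of senders it has collected. *)
Inductive control n :=
  | NextRound
  | Broadcast of {set 'I_n}
  | Wait
  | Update of {set 'I_n}.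
Arguments NextRound {n}.
Arguments Wait {n}.

Record local_state n := LocalState {
  at_line : control n;
  round : nat;
  suspect : {set 'I_n}
}.

Definition initial_state n : local_state n := LocalState NextRound 0 set0.

(* The messages received by a process, each tagged with its sender. *)
Definition inbox n := seq ('I_n * message).

Definition received_count n (r : nat) (ib : inbox n) : nat :=
  count (fun x => x.2 == ALIVE r) ib.

Definition senders n (r : nat) (ib : inbox n) : {set 'I_n} :=
  [set q | (q, ALIVE r) \in ib].

(* [exec a ib s out s'] is one step of the code, executed in local state s when
   the failure detector module returns a and the messages received so far are
   ib; out is the message sent by the step, with its destination, if any. *)
Inductive exec n (a : nat) (ib : inbox n) :
    local_state n -> option ('I_n * message) -> local_state n -> Prop :=
  | exec_next_round r S :
      exec a ib (LocalState NextRound r S) None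
                (LocalState (Broadcast [set: 'I_n]) r.+1 S)
  | exec_send r S (D : {set 'I_n}) q : q \in D ->
      exec a ib (LocalState (Broadcast D) r S) (Some (q, ALIVE r))
                (LocalState (Broadcast (D :\ q)) r S)
  | exec_sent r S :
      exec a ib (LocalState (Broadcast set0) r S) None (LocalState Wait r S)
  | exec_keep_waiting r S : received_count r ib < a ->
      exec a ib (LocalState Wait r S) None (LocalState Wait r S)
  | exec_stop_waiting r S : a <= received_count r ib ->
      exec a ib (LocalState Wait r S) None
                (LocalState (Update (senders r ib)) r S)
  | exec_update r S AL :
      exec a ib (LocalState (Update AL) r S) None
                (LocalState NextRound r (~: AL)).

(* What a process does at a time instant. *)
Inductive action n :=
  | Idle
  | Receive of 'I_n & message
  | Step of option ('I_n * message).
Arguments Idle {n}.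

Definition receipt n (x : action n) : inbox n :=
  if x is Receive q m then [:: (q, m)] else [::].

(* What process q, doing x, sends to process p. *)
Definition sent_to n (x : action n) (p : 'I_n) : seq message :=
  if x is Step (Some (p', m)) then (if p' == p then [:: m] else [::])
  else [::].

Definition received_from n (x : action n) (q : 'I_n) : seq message :=
  if x is Receive q' m then (if q' == q then [:: m] else [::]) else [::].

(* [channel t q p] is the multiset of messages in transit from q to p.
   [state t], [received t] and [channel t] describe time t before the actions
   [act t] take effect. *)
Record execution n := Execution {
  state : nat -> 'I_n -> local_state n;
  received : nat -> 'I_n -> inbox n;
  channel : nat -> 'I_n -> 'I_n -> seq message;
  act : nat -> 'I_n -> action n
}.

Record is_run n (f : nat) (F : nat -> {set 'I_n}) (H : 'I_n -> nat -> 'I_n.+1)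
    (E : execution n) : Prop := {
  run_state0 : forall p, state E 0 p = initial_state n;
  run_received0 : forall p, received E 0 p = [::];
  run_channel0 : forall q p, channel E 0 q p = [::];
  run_crash : forall t p, p \in F t -> act E t p = Idle;
  run_step : forall t p out, act E t p = Step out ->
    exec (dN_alive f H p t) (received E t p) (state E t p) out
         (state E t.+1 p);
  run_no_step : forall t p, (forall out, act E t p <> Step out) ->
    state E t.+1 p = state E t p;
  run_received : forall t p,
    received E t.+1 p = receipt (act E t p) ++ received E t p;
  (* channels neither create, nor duplicate, nor lose messages *)
  run_receive : forall t q p m, act E t p = Receive q m ->
    m \in channel E t q p;
  run_channel : forall t q p,
    perm_eq (received_from (act E t p) q ++ channel E t.+1 q p)
            (channel E t q p ++ sent_to (act E t q) p);
  (* a correct process executes its code forever *)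
  run_fair : forall t p, p \in correct F ->
    exists t' out, t <= t' /\ act E t' p = Step out;
  (* message delays are unbounded but finite *)
  run_delivery : forall t q p m, p \in correct F -> m \in channel E t q p ->
    exists t', t <= t' /\ act E t' p = Receive q m
}.

(* Properties of an emulated detector output: [S t p] is the set of processes
   suspected by p at time t. *)

Definition strong_completeness n (F : nat -> {set 'I_n})
    (S : nat -> 'I_n -> {set 'I_n}) : Prop :=
  exists t, forall t' q p, t <= t' -> q \in crashed F -> p \in correct F ->
    q \in S t' p.

Definition eventual_strong_accuracy n (F : nat -> {set 'I_n})
    (S : nat -> 'I_n -> {set 'I_n}) : Prop :=
  exists t, forall t' q p, t <= t' -> q \in correct F -> p \in correct F ->
    q \notin S t' p.

Definition suspects n (E : execution n) (t : nat) (p : 'I_n) : {set 'I_n} :=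
  suspect (state E t p).

(* Main.v *)
(** Channels conserve messages, so [(ALIVE, r)] from q has reached p or is in
    transit to p exactly once as soon as q has sent it, and never otherwise.
    Hence every correct process eventually receives the round-r message of every
    correct process, and no wait blocks forever once the detector returns the
    number of correct processes.  A process that crashes takes part in finitely
    many rounds only.  In all later rounds messages come from correct processes
    only, so collecting as many as there are correct processes collects exactly
    [correct F]. *)

Require Import Defs.
From mathcomp Require Import all_boot.
From mathcomp Require Import boolp.

Set Implicit Arguments.
Unset Strict Implicit.
Unset Printing Implicit Defensive.

Lemma eventually_all (T : finType) (A : {set T}) (P : T -> nat -> Prop) :
  (forall x, x \in A -> exists t, forall t', t <= t' -> P x t') ->
  exists t, forall t' x, t <= t' -> x \in A -> P x t'.
Proof.
move=> ev.
have /choice[w Pw] x : exists t, x \in A -> forall t', t <= t' -> P x t'.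
  have [/ev[t Pt]|_] := boolP (x \in A); first by exists t.
  by exists 0.
exists (\max_x w x) => t' x le_t' Ax.
by apply: Pw => //; apply: leq_trans le_t'; apply: leq_bigmax.
Qed.

(** * Counting messages and their senders *)

Lemma received_countE n r (ib : inbox n) :
  received_count r ib = \sum_q count_mem (q, ALIVE r) ib.
Proof.
elim: ib => [|[q m] ib IH] /=; first by rewrite big1.
rewrite big_split /= -IH -[in LHS]/(received_count r ib); congr (_ + _).
rewrite (bigD1 q) //= big1 ?addn0 => [|q' /negPf ne_q'].
  by rewrite xpair_eqE eqxx.
by rewrite xpair_eqE eq_sym ne_q'.
Qed.

Lemma card_senders n r (ib : inbox n) :
  #|senders r ib| = \sum_q ((q, ALIVE r) \in ib).
Proof.
rewrite -sum1_card big_mkcond; apply: eq_bigr => q _.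
by rewrite in_set; case: (_ \in ib).
Qed.

Lemma leq_senders_received n r (ib : inbox n) :
  #|senders r ib| <= received_count r ib.
Proof.
rewrite card_senders received_countE; apply: leq_sum => q _.
rewrite -has_pred1 has_count.
by case: (count _ ib).
Qed.

(** The wait counts messages whereas [AL] collects senders; without duplicates the two agree. *)
Lemma received_count_senders n r (ib : inbox n) :
  (forall q, count_mem (q, ALIVE r) ib <= 1) ->
  received_count r ib = #|senders r ib|.
Proof.
move=> le1; rewrite card_senders received_countE; apply: eq_bigr => q _.
by rewrite -has_pred1 has_count; case: (count _ ib) (le1 q) => [|[]].
Qed.

(* Meaningful for r > 0: the initial state counts as having sent round 0. *)
Definition has_sent n (s : local_state n) (r : nat) (p : 'I_n) : bool :=
  (r < round s) ||
  (r == round s) && (if at_line s is Broadcast D then p \notin D else true).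

(* The number of the last round whose iteration of the loop is over. *)
Definition completed n (s : local_state n) : nat :=
  if at_line s is NextRound then round s else (round s).-1.

(** Stated between numbers, so that it also rules out a second sending: [D] loses each destination
    once served and is refilled only for a new round. *)
Lemma exec_has_sent n a ib (s s' : local_state n) out r p :
  exec a ib s out s' ->
  has_sent s' r p =
    has_sent s r p + count_mem (ALIVE r) (sent_to (Step out) p) :> nat.
Proof.
case=> {s out s'} [r' S|r' S D q qD|r' S|r' S _|r' S _|r' S AL];
  rewrite /has_sent /= ?addn0 ?inE ?andbT ?andbF ?orbF //.
- by rewrite ltnS leq_eqVlt orbC.
- rewrite [q == p]eq_sym; case: (p =P q) => [->|_] /=; last by rewrite addn0.
  rewrite qD /= addn0 andbT andbF orbF.
  rewrite (_ : (ALIVE r' == ALIVE r) = (r' == r)) //.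
  by case: ltngtP.
Qed.

Lemma exec_round n a ib (s s' : local_state n) out :
  exec a ib s out s' -> round s <= round s' <= (round s).+1.
Proof. by case=> *; rewrite /= leqnn ?leqnSn. Qed.

Lemma exec_completed n a ib (s s' : local_state n) out :
  exec a ib s out s' -> completed s <= completed s'.
Proof. by case=> *; rewrite /completed //= leq_pred. Qed.

(** * Invariants of runs: rounds and conservation of messages *)

Section Runs.

Variables (n f : nat) (F : nat -> {set 'I_n}) (H : 'I_n -> nat -> 'I_n.+1).
Variable E : execution n.
Hypothesis fp : failure_pattern f F.
Hypothesis adm : dN_admissible F H.
Hypothesis run : is_run f F H E.

Lemma state_stepP t p :
  state E t.+1 p = state E t p /\ (forall out, act E t p <> Step out) \/
  exists2 out, act E t p = Step out &
    exec (dN_alive f H p t) (received E t p) (state E t p) out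
         (state E t.+1 p).
Proof.
case e: (act E t p) => [|q m|out]; last first.
- by right; exists out => //; apply: (run_step run).
- by left; split=> //; apply: (run_no_step run) => out; rewrite e.
- by left; split=> //; apply: (run_no_step run) => out; rewrite e.
Qed.

Lemma completed_mono p t t' : t <= t' ->
  completed (state E t p) <= completed (state E t' p).
Proof.
move=> /subnK <-; elim: (t' - t) => // k IH; rewrite addSn.
case: (state_stepP (k + t) p) => [[-> _]//|[out _ /exec_completed]].
exact: leq_trans.
Qed.

(** A step raises the round by at most one. Thus a process in a round above T is past time T, by
    which late rounds see a stable detector. *)
Lemma leq_round_time p t : round (state E t p) <= t.
Proof.
elim: t => [|t IH]; first by rewrite (run_state0 run).
case: (state_stepP t p) => [[-> _]|[out _ /exec_round/andP[_ le]]].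
  exact: leqW.
exact: leq_trans le _.
Qed.

Lemma received_mono p t t' x : t <= t' ->
  x \in received E t p -> x \in received E t' p.
Proof.
move=> /subnK <- xt; elim: (t' - t) => // k IH.
by rewrite addSn (run_received run) mem_cat IH orbT.
Qed.

(** A receipt moves the message from the second summand to the first; a send raises the second
    summand and the right side together. Round 0 is left out because the initial state counts as
    having sent it. *)
Lemma channel_conservation t q p r :
  count_mem (q, ALIVE r.+1) (received E t p)
    + count_mem (ALIVE r.+1) (channel E t q p)
  = has_sent (state E t q) r.+1 p.
Proof.
elim: t => [|t IH].
  by rewrite (run_received0 run) (run_channel0 run) (run_state0 run).
have -> : has_sent (state E t.+1 q) r.+1 p = has_sent (state E t q) r.+1 p
    + count_mem (ALIVE r.+1) (sent_to (act E t q) p) :> nat.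
  case: (state_stepP t q) => [[-> nstep]|[out -> /exec_has_sent->//]].
  by case: (act E t q) nstep => [_|q' m _|out /(_ out)//] /=; rewrite addn0.
have /permP/(_ (pred1 (ALIVE r.+1))) := run_channel run t q p.
rewrite !count_cat -IH -addnA => <-.
rewrite (run_received run) count_cat [RHS]addnA; congr (_ + _).
rewrite addnC; congr (_ + _).
case: (act E t p) => // q' m /=; rewrite xpair_eqE.
by case: (q' =P q).
Qed.

Lemma count_received_le1 t q p r :
  count_mem (q, ALIVE r.+1) (received E t p) <= 1.
Proof.
have := leq_b1 (has_sent (state E t q) r.+1 p).
by rewrite -channel_conservation; apply: leq_trans; apply: leq_addr.
Qed.

Lemma received_has_sent t q p r :
  (q, ALIVE r.+1) \in received E t p -> has_sent (state E t q) r.+1 p.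
Proof.
rewrite -has_pred1 has_count => gt0; rewrite -[has_sent _ _ _]lt0b.
by rewrite -channel_conservation addn_gt0 gt0.
Qed.

Lemma has_sent_received t q p r : p \in correct F ->
  has_sent (state E t q) r.+1 p ->
  exists t', (q, ALIVE r.+1) \in received E t' p.
Proof.
move=> pC; rewrite -[has_sent _ _ _]lt0b -channel_conservation addn_gt0.
rewrite -!has_count !has_pred1 => /orP[|inch]; first by exists t.
have [t' [_ rcv]] := run_delivery run pC inch.
by exists t'.+1; rewrite (run_received run) rcv /= mem_head.
Qed.

(** * Safety: what late rounds collect *)

Lemma crashedP q : reflect (exists t, q \in F t) (q \in crashed F).
Proof. by rewrite inE; apply: asboolP. Qed.

Lemma failure_mono t t' : t <= t' -> F t \subset F t'.
Proof.
move=> /subnK <-; elim: (t' - t) => // k IH; rewrite addSn.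
exact: subset_trans IH (fp_crash_stop fp _).
Qed.

Lemma crashed_round_bounded :
  exists R, forall t q, q \in crashed F -> round (state E t q) <= R.
Proof.
(* The index in [eventually_all] is here a bound on rounds, not a time; the crash time of q serves,
   since q is frozen afterwards. *)
have [|R bR] := @eventually_all _ (crashed F)
    (fun q R => forall t, round (state E t q) <= R).
  move=> q /crashedP[tq qF]; exists tq => R le_R t.
  apply: leq_trans le_R.
  have [le_t|/ltnW/subnK <-] := leqP t tq.
    exact: leq_trans (leq_round_time _ _) le_t.
  elim: (t - tq) => [|k IH]; first exact: leq_round_time.
  rewrite addSn (run_no_step run) // => out.
  rewrite (run_crash run) //.
  by apply: (subsetP (failure_mono (leq_addl k tq))).
by exists R => t q qF; apply: (bR R q).
Qed.

Lemma card_correct : #|correct F| = n - #|crashed F|.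
Proof. by rewrite cardsCs setCK card_ord. Qed.

(** The floor [n - f] is harmless: at most f processes crash, so it never exceeds the number of
    correct ones. *)
Lemma dN_alive_stable :
  exists T, forall t p, T < t -> p \in correct F ->
    dN_alive f H p t = #|correct F|.
Proof.
have [[T1 compl] [T2 acc]] := adm.
exists (maxn T1 T2) => t p; rewrite gtn_max => /andP[lt1 lt2] pC.
rewrite /dN_alive; have -> : H p t = #|crashed F| :> nat.
  by apply/eqP; rewrite eqn_leq acc // compl // ltnW.
rewrite card_correct; apply/maxn_idPl.
exact: leq_sub2l (fp_at_most_f fp).
Qed.

Lemma late_rounds_safe : exists R, forall t p, p \in correct F ->
  let s := state E t p in
  (forall AL, at_line s = Update AL -> R < round s -> AL = correct F) /\
  (R < completed s -> suspect s = crashed F).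
Proof.
have [R0 crashedR] := crashed_round_bounded.
have [T stable] := dN_alive_stable.
(* Above [R0] no crashed process sends; above [T] the time is past [T] as well. The first conjunct
   carries [AL] from the end of the wait to the assignment of [suspect]. *)
exists (maxn R0 T) => t p pC /=; elim: t => [|t [IHu IHs]].
  by rewrite (run_state0 run).
case: (state_stepP t p) => [[->//]|[out _ ex]].
inversion ex as [r S Es Eo Es'|r S D q _ Es Eo Es'|r S Es Eo Es'
  |r S _ Es Eo Es'|r S ge Es Eo Es'|r S AL Es Eo Es'];
  rewrite -Es /completed /= in IHu IHs *; split=> //.
- move=> _ [<-] ltr.
  case: r ltr Es ge {IHu IHs Es' ex} => // r ltr Es ge.
  move: ltr; rewrite gtn_max => /andP[ltR0 ltT].
  (* Every sender is correct, and there are at least as many senders as correct processes. *)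
  apply/eqP; rewrite eqEcard; apply/andP; split.
    apply/subsetP=> q; rewrite /senders in_set => /received_has_sent sent.
    rewrite inE; apply/negP=> /(crashedR t) le_q.
    have : r.+1 <= round (state E t q).
      by move: sent; rewrite /has_sent => /orP[/ltnW|/andP[/eqP<-]].
    by move=> /(leq_trans ltR0); rewrite ltnNge le_q.
  rewrite -received_count_senders; last by move=> q; apply: count_received_le1.
  rewrite -(stable t p) //; apply: leq_trans ltT _.
  by have := leq_round_time p t; rewrite -Es.
- by move=> ltr; rewrite (IHu AL) // /correct setCK.
Qed.

(** * Liveness: no correct process blocks *)

(** Only its own steps change the state of p, so its first step from t on starts in the state of
    time t. *)
Lemma next_step t p : p \in correct F -> exists t' out,
  [/\ t <= t', state E t' p = state E t p &
    exec (dN_alive f H p t') (received E t' p) (state E t' p) out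
         (state E t'.+1 p)].
Proof.
move=> pC; have [t1 [out [le_t1 step1]]] := run_fair run t pC.
rewrite -(subnK le_t1) in step1; move: (t1 - t) step1 => k {le_t1}.
elim: k t => [|k IH] t step1.
  by exists t, out; split=> //; apply: (run_step run).
case: (state_stepP t p) => [[eq_s _]|[out' _ ex]]; last by exists t, out'.
have [|t' [out' [lt ? ?]]] := IH t.+1; first by rewrite addnS -addSn.
by exists t', out'; split=> //; [apply: ltnW | rewrite -eq_s].
Qed.

Lemma broadcast_terminates t p r S D : p \in correct F ->
  state E t p = LocalState (Broadcast D) r S ->
  exists2 t', t <= t' & state E t' p = LocalState Wait r S.
Proof.
move=> pC; have [k] := ubnP #|D|; elim: k D t => // k IH D t ltD Et.
have [t1 [out [le1 E1 ex]]] := next_step t pC.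
rewrite E1 Et in ex; inversion ex as [|r' S' D' q qD|r' S' eD Eo Es| | |].
  have [| |t2 lt2 E2] := IH (D :\ q) t1.+1; rewrite -?Es //.
    by rewrite (cardsD1 q D) qD in ltD.
  by exists t2 => //; apply: leq_trans lt2; apply: leqW.
by exists t1.+1; [apply: leqW|].
Qed.

Lemma has_sent_after_broadcast t q r S p :
  state E t q = LocalState Wait r S -> has_sent (state E t q) r p.
Proof. by move=> ->; rewrite /has_sent /= eqxx orbT. Qed.

Definition reaches_round_end r p := exists t S,
  state E t p = LocalState NextRound r S.

Lemma wait_reached r p : p \in correct F -> reaches_round_end r p ->
  exists t S, state E t p = LocalState Wait r.+1 S.
Proof.
move=> pC [t [S Et]].
have [t1 [out [le1 E1 ex]]] := next_step t pC.
rewrite E1 Et in ex; inversion ex as [r' S' eS Eo Es| | | | |].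
have [t2 _ E2] := broadcast_terminates pC (esym Es).
by exists t2, S.
Qed.

Lemma round_messages_received r p :
  (forall q, q \in correct F -> reaches_round_end r q) -> p \in correct F ->
  exists t, forall t', t <= t' ->
    #|correct F| <= received_count r.+1 (received E t' p).
Proof.
move=> reached pC.
have [|t rcv] := @eventually_all _ (correct F)
    (fun q t => (q, ALIVE r.+1) \in received E t p).
  move=> q qC; have [t [S Et]] := wait_reached qC (reached q qC).
  have [t1 rcv] := has_sent_received pC (has_sent_after_broadcast p Et).
  by exists t1 => t' /received_mono; apply.
exists t => t' le_t; apply: leq_trans (leq_senders_received _ _).
by apply/subset_leq_card/subsetP=> q qC; rewrite in_set rcv.
Qed.

Lemma wait_terminates t p r S :
  (forall q, q \in correct F -> reaches_round_end r q) -> p \in correct F ->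
  state E t p = LocalState Wait r.+1 S ->
  exists t' AL, state E t' p = LocalState (Update AL) r.+1 S.
Proof.
move=> reached pC Et.
have [t1 enough] := round_messages_received reached pC.
have [T stable] := dN_alive_stable.
(* From m on, enough messages are there and the detector is stable, strictly after [T]. The wait may
   end earlier, on another detector value; otherwise the first step from m on ends it. *)
pose m := maxn t1 T.+1.
have [t2 ltm] : exists t2, m <= t2 + t by exists m; apply: leq_addr.
have [//|E2] : (exists t' AL, state E t' p = LocalState (Update AL) r.+1 S) \/
    state E (t2 + t) p = LocalState Wait r.+1 S.
  elim: t2 {ltm} => [|k [IH|IH]]; [by right|by left|rewrite addSn].
  case: (state_stepP (k + t) p) => [[-> _]|[out _ ex]]; first by right.
  rewrite IH in ex; inversion ex; first by right.
  by left; exists (k + t).+1, (senders r.+1 (received E (k + t) p)).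
have [t3 [out [le3 E3 ex]]] := next_step (t2 + t) pC.
have := leq_trans ltm le3; rewrite geq_max => /andP[le1 leT].
rewrite E3 E2 stable // in ex.
inversion ex as [| | |r' S' few|r' S' enough' Er Eo Es|].
  by have := leq_trans few (enough _ le1); rewrite ltnn.
by exists t3.+1, (senders r.+1 (received E t3 p)).
Qed.

(** Induction on r for all correct processes at once, as each needs the messages of all the others.
    The initial state serves as the end of round 0. *)
Lemma round_ends r p : p \in correct F -> reaches_round_end r p.
Proof.
elim: r p => [|r IH] p pC.
  by exists 0, set0; rewrite (run_state0 run).
have [t [S Et]] := wait_reached pC (IH p pC).
have [t1 [AL E1]] := wait_terminates IH pC Et.
have [t2 [out [_ E2 ex]]] := next_step t1 pC.
rewrite E2 E1 in ex; inversion ex.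
by exists t2.+1, (~: AL).
Qed.

Lemma eventually_suspect_crashed :
  exists t, forall t' p, t <= t' -> p \in correct F ->
    suspects E t' p = crashed F.
Proof.
have [R safe] := late_rounds_safe.
apply: eventually_all => p pC.
(* Safety holds for completed rounds strictly above R, hence [R.+1]. *)
have [t [S Et]] := round_ends R.+1 pC.
exists t => t' le_t; apply: (safe t' p pC).2.
by apply: leq_trans (completed_mono p le_t); rewrite Et.
Qed.

End Runs.

Theorem theorem3p1 (n f : nat) (F : nat -> {set 'I_n})
    (H : 'I_n -> nat -> 'I_n.+1) (E : execution n) :
  failure_pattern f F ->
  dN_admissible F H ->
  is_run f F H E ->
  strong_completeness F (suspects E) /\
  eventual_strong_accuracy F (suspects E).
Proof.
move=> fp adm run.
have [t suspectE] := eventually_suspect_crashed fp adm run.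
split; exists t => t' q p le_t.
  by move=> qF pC; rewrite suspectE.
by move=> qC pC; rewrite suspectE // -in_setC.
Qed.
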